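(* If an instance of Minimum Multiway Cut is $4$-stable, then its LP relaxation (described in the context) is integral: every optimal LP solution satisfies $\bar u\in\{e_1,\dots,e_k\}$ for all $u\in V$.
   Context: Minimum Multiway Cut: given a graph $G=(V,E,w)$ with positive edge weights and terminals $s_1,\dots,s_k\in V$, find a partition $S_1,\dots,S_k$ of $V$ with $s_i\in S_i$ minimizing the total weight of edges whose endpoints lie in different parts (cut edges). The instance is $\gamma$-stable ($\gamma>1$) if, letting $\mathcal S^*$ be an optimal multiway cut with cut edge set $E^*$, every multiway cut $\mathcal S'\neq\mathcal S^*$ with cut edge set $E'$ satisfies $w(E'\setminus E^* )>\gamma\, w(E^*\setminus E')$ (equivalently, $\mathcal S^*$ is the unique optimal solution for every $G'=(V,E,w')$ with $w\le w'\le\gamma w$). LP relaxation: variables $\bar u\in\mathbb R^k$ for $u\in V$; minimize $\frac12\sum_{(u,v)\in E}w(u,v)\|\bar u-\bar v\|_1$ subject to $\bar s_i=e_i$ (standard basis vectors) and $\bar u\in\Delta=\{x:\|x\|_1=1,x\ge0\}$ for all $u$. *)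

(* Defs.v *)
From HB Require Import structures.
From mathcomp Require Import all_boot all_order all_algebra.
From mathcomp Require Import reals.

Set Implicit Arguments.
Unset Strict Implicit.
Unset Printing Implicit Defensive.

Import Order.TTheory GRing.Theory Num.Theory.
Local Open Scope ring_scope.

Record mwc_instance (R : realType) (V : finType) (k : nat) := MwcInstance {
  adj : rel V;
  weight : V -> V -> R;
  terminal : 'I_k -> V;
  adj_sym : symmetric adj;
  adj_irr : irreflexive adj;
  weight_sym : forall u v, weight u v = weight v u;
  weight_gt0 : forall u v, adj u v -> 0 < weight u v
}.

Section MultiwayCut.
Variables (R : realType) (V : finType) (k : nat) (I : mwc_instance R V k).

(* A set of undirected edges is encoded as a symmetric set of ordered pairs:
   the edge uv is present as both (u, v) and (v, u). *)
Definition edges : {set V * V} := [set p | adj I p.1 p.2].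

(* The factor 1/2 makes each undirected edge count exactly once. *)
Definition edge_sum (F : {set V * V}) (f : V -> V -> R) : R :=
  2^-1 * \sum_(p in F) f p.1 p.2.

Definition edges_weight (F : {set V * V}) : R := edge_sum F (weight I).

(* Distinctness of the terminals is forced by the existence of such an S. *)
Definition is_multiway_cut (S : {ffun 'I_k -> {set V}}) : Prop :=
  [/\ forall i, terminal I i \in S i,
      forall i j, i != j -> [disjoint S i & S j]
    & \bigcup_i S i = [set: V]].

Definition cut_edges (S : {ffun 'I_k -> {set V}}) : {set V * V} :=
  [set p in edges | ~~ [exists i, (p.1 \in S i) && (p.2 \in S i)]].

Definition is_optimal_multiway_cut (S : {ffun 'I_k -> {set V}}) : Prop :=
  is_multiway_cut S /\
  forall S', is_multiway_cut S' ->
    edges_weight (cut_edges S) <= edges_weight (cut_edges S').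

Definition stable (gamma : R) : Prop :=
  1 < gamma /\
  exists2 S, is_optimal_multiway_cut S &
    forall S', is_multiway_cut S' -> S' <> S ->
      gamma * edges_weight (cut_edges S :\: cut_edges S')
        < edges_weight (cut_edges S' :\: cut_edges S).

(* The library norm on matrices is the sup norm, hence an explicit l1 norm. *)
Definition l1norm (x : 'rV[R]_k) : R := \sum_i `|x 0 i|.

Definition std_basis (i : 'I_k) : 'rV[R]_k := delta_mx 0 i.

Definition in_simplex (x : 'rV[R]_k) : Prop :=
  l1norm x = 1 /\ forall i, 0 <= x 0 i.

Definition lp_feasible (x : V -> 'rV[R]_k) : Prop :=
  (forall i, x (terminal I i) = std_basis i) /\ forall u, in_simplex (x u).

Definition lp_value (x : V -> 'rV[R]_k) : R :=
  2^-1 * edge_sum edges (fun u v => weight I u v * l1norm (x u - x v)).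

Definition lp_optimal (x : V -> 'rV[R]_k) : Prop :=
  lp_feasible x /\ forall y, lp_feasible y -> lp_value x <= lp_value y.

End MultiwayCut.

Arguments std_basis {R k} i.

(* Main.v *)
Require Import Defs.
From HB Require Import structures.
From mathcomp Require Import all_boot all_order all_algebra.
From mathcomp Require Import reals.
From mathcomp Require Import lra.

(** Let [S], with labelling [j], be the optimal cut and [x] an LP optimum.  For
    a part [i] and a threshold [r >= 0], relabel by [i] every vertex [u] with
    [r < x u i].  Summed over [i] and integrated over [r], an edge [uv] which
    [S] does not cut becomes cut with mass at most [||x u - x v||_1], and an
    edge which [S] cuts becomes uncut with mass at least
    [sum_i min (x u i) (x v i) = 1 - ||x u - x v||_1 / 2].  As the LP value of
    [x] is at most the weight of [S], the mean over these cuts of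
    [w(E' \ E) - 4 w(E \ E')] is nonpositive, where [E] and [E'] are the edges
    cut by [S] and by the new cut; stability makes it positive as soon as one
    of the new cuts of positive mass differs from [S].  So no vertex is ever relabelled,
    i.e. [x u i = 0] for [i <> j u]. *)

Set Implicit Arguments.
Unset Strict Implicit.
Unset Printing Implicit Defensive.

Import Order.TTheory GRing.Theory Num.Theory.
Local Open Scope ring_scope.

(* The integral over thresholds is replaced by a finite list of pairs
   (mass, threshold), exact on the finitely many values in [s]. *)
Lemma layer_cake_path (R : realDomainType) (s : seq R) (a : R) :
  path <=%R a s ->
  exists2 L : seq (R * R), {in L, forall q : R * R, 0 <= q.1 /\ a <= q.2} &
    {in s, forall t, \sum_(q <- L) q.1 * (q.2 < t)%R%:R = t - a}.
Proof.
elim: s a => [|b s IH] a /=; first by move=> _; exists [::].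
case/andP=> ab pbs; have [L posL sumL] := IH b pbs.
(* The new layer stands for the interval from [a] to [b]. Every [t] in the list is at least [b], so
   it passes the test [a < t] unless [t = a = b], when the mass is zero anyway. *)
exists ((b - a, a) :: L) => [q | t].
  rewrite inE => /predU1P[-> /= | /posL[q1 q2]]; first by rewrite subr_ge0.
  by split=> //; apply: le_trans q2.
rewrite inE big_cons /= => /predU1P[-> | ts].
  rewrite big1_seq => [|q /posL[_ q2]]; last by rewrite ltNge q2 mulr0.
  rewrite addr0; case: ltP => [_ | ba]; first by rewrite mulr1.
  by rewrite mulr0; lra.
rewrite (sumL _ ts).
have bt : b <= t := allP (order_path_min le_trans pbs) _ ts.
by case: ltP => [_|ta]; rewrite ?mulr1 ?mulr0; lra.
Qed.

Lemma layer_cake (R : realDomainType) (s : seq R) :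
  {in s, forall t, 0 <= t} ->
  exists2 L : seq (R * R), {in L, forall q : R * R, 0 <= q.1 /\ 0 <= q.2} &
    {in s, forall t, \sum_(q <- L) q.1 * (q.2 < t)%R%:R = t}.
Proof.
move=> s_ge0.
have /layer_cake_path[L posL sumL] : path <=%R 0 (sort <=%R s).
  rewrite path_sortedE; last exact: le_trans.
  rewrite sort_le_sorted andbT.
  by apply/allP=> t; rewrite mem_sort => /s_ge0.
by exists L => // t ts; rewrite sumL ?mem_sort // subr0.
Qed.

Lemma normr_sub_min (R : realDomainType) (a b : R) :
  `|a - b| = a + b - 2 * Num.min a b.
Proof.
by case: (leP a b) => ab; [rewrite ler0_norm | rewrite gtr0_norm]; lra.
Qed.

(** * The l1 distance on the simplex *)

Section Simplex.
Variables (R : realType) (k : nat).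
Implicit Types x y : 'rV[R]_k.

Lemma in_simplex_sum x : in_simplex x -> \sum_i x 0 i = 1.
Proof.
by case=> <- x_ge0; apply: eq_bigr => i _; rewrite ger0_norm.
Qed.

Lemma l1norm_sub_simplex x y : in_simplex x -> in_simplex y ->
  l1norm (x - y) = 2 - 2 * \sum_i Num.min (x 0 i) (y 0 i).
Proof.
move=> /in_simplex_sum sx /in_simplex_sum sy; rewrite /l1norm.
under eq_bigr => i _ do rewrite !mxE normr_sub_min.
by rewrite sumrB big_split /= sx sy -mulr_sumr; lra.
Qed.

Lemma in_simplex_std_basis (i : 'I_k) : in_simplex (std_basis i : 'rV[R]_k).
Proof.
split=> [|l]; last by rewrite mxE ler0n.
rewrite /l1norm (bigD1 i) //= big1 => [|l li]; last first.
  by rewrite mxE (negPf li) normr0.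
by rewrite mxE !eqxx normr1 addr0.
Qed.

Lemma l1norm_sub_std_basis (i l : 'I_k) :
  l1norm (std_basis i - std_basis l : 'rV[R]_k) = 2 * (i != l)%:R.
Proof.
rewrite (l1norm_sub_simplex (in_simplex_std_basis i) (in_simplex_std_basis l)).
rewrite (bigD1 i) //= big1 => [|m mi]; rewrite !mxE eqxx /=; last first.
  by rewrite (negPf mi) min_l ?ler0n.
by rewrite eqxx; case: eqP => _; rewrite /= ?minxx ?(min_r ler01); lra.
Qed.

Lemma simplex_vertex x (i : 'I_k) : in_simplex x ->
  (forall l, l != i -> x 0 l = 0) -> x = std_basis i.
Proof.
move=> /in_simplex_sum; rewrite (bigD1 i) //= => sx x0.
apply/rowP=> l; rewrite !mxE eqxx /=; case: eqVneq => [-> | /x0 //].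
by rewrite -sx big1 ?addr0.
Qed.

End Simplex.

(** * Cuts as vertex labellings *)

Section Labelling.
Variables (R : realType) (V : finType) (k : nat) (I : mwc_instance R V k).
Implicit Types f g : V -> 'I_k.

Definition cut_of f : {ffun 'I_k -> {set V}} := [ffun i => [set u | f u == i]].

Lemma multiway_cut_of f : (forall i, f (terminal I i) = i) ->
  is_multiway_cut I (cut_of f).
Proof.
move=> fT; split=> [i | i l il |]; first by rewrite ffunE inE fT.
  rewrite -setI_eq0; apply/eqP/setP=> u; rewrite !ffunE !inE.
  by case: eqP => // ->; rewrite (negPf il).
apply/setP=> u; rewrite inE; apply/bigcupP; exists (f u) => //.
by rewrite ffunE inE.
Qed.

Lemma mem_cut_edges_cut_of f p :
  (p \in cut_edges I (cut_of f)) = (p \in edges I) && (f p.1 != f p.2).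
Proof.
rewrite inE; congr (_ && ~~ _); apply/existsP/eqP => [[i]|fp].
  by rewrite ffunE !inE => /andP[/eqP-> /eqP->].
by exists (f p.1); rewrite ffunE !inE fp eqxx.
Qed.

Lemma multiway_cut_labelling S : is_multiway_cut I S ->
  exists2 f, S = cut_of f & forall i, f (terminal I i) = i.
Proof.
case=> ST Sdisj Scov.
have ex u : exists i, u \in S i.
  have /bigcupP[i _ ui] : u \in \bigcup_i S i by rewrite Scov inE.
  by exists i.
pose f u := xchoose (ex u).
have fE u i : u \in S i -> f u = i.
  move=> ui; apply/eqP/negPn/negP=> /Sdisj; rewrite -setI_eq0 => /eqP/setP/(_ u).
  by rewrite !inE ui (xchooseP (ex u)).
exists f => [|i]; last exact: fE.
apply/ffunP=> i; rewrite ffunE; apply/setP=> u; rewrite inE.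
by apply/idP/eqP => [/fE //|<-]; exact: (xchooseP (ex u)).
Qed.

Lemma edge_sum_indicator (P : pred (V * V)) (F : {set V * V}) :
  (forall p, (p \in F) = (p \in edges I) && P p) ->
  edges_weight I F = 2^-1 * \sum_(p in edges I) weight I p.1 p.2 * (P p)%:R.
Proof.
move=> FE; rewrite /edges_weight /edge_sum; congr (_ * _).
rewrite (eq_bigl _ _ FE) big_mkcondr; apply: eq_bigr => p _.
by case: (P p); rewrite ?mulr1 ?mulr0.
Qed.

Definition std_solution f u : 'rV[R]_k := std_basis (f u).

Lemma lp_feasible_std_solution f : (forall i, f (terminal I i) = i) ->
  lp_feasible I (std_solution f).
Proof.
move=> fT; split=> [i|u]; first by rewrite /std_solution fT.
exact: in_simplex_std_basis.
Qed.

(** Per-edge summand of the stability gap when [g] replaces [f]: 1 for an edge newly cut, -4 for one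
    no longer cut, 4 being the stability factor. *)
Definition excess_weight f g (u v : V) : R :=
  (f u == f v)%:R * (g u != g v)%:R - 4 * ((f u != f v)%:R * (g u == g v)%:R).

Lemma excess_weightE f g :
  edges_weight I (cut_edges I (cut_of g) :\: cut_edges I (cut_of f))
    - 4 * edges_weight I (cut_edges I (cut_of f) :\: cut_edges I (cut_of g))
  = 2^-1 * \sum_(p in edges I) weight I p.1 p.2 * excess_weight f g p.1 p.2.
Proof.
have ED f1 f2 p : (p \in cut_edges I (cut_of f1) :\: cut_edges I (cut_of f2))
    = (p \in edges I) && ((f2 p.1 == f2 p.2) && (f1 p.1 != f1 p.2)).
  by rewrite in_setD !mem_cut_edges_cut_of; case: (p \in edges I); rewrite ?negbK.
rewrite !(edge_sum_indicator (ED _ _)) mulrCA -mulrBr mulr_sumr -sumrB.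
congr (_ * _); apply: eq_bigr => p _; rewrite /excess_weight -!natrM !mulnb.
by rewrite (andbC (g _ == _)); lra.
Qed.

End Labelling.

Arguments cut_of {V k} f.
Arguments excess_weight {R V k} f g u v.

(** * Threshold rounding, edge by edge *)

Section Rounding.
Variables (R : realType) (V : finType) (k : nat).
Variables (x : V -> 'rV[R]_k) (j : V -> 'I_k).
Hypothesis x_simplex : forall u, in_simplex (x u).

Definition relabel (i : 'I_k) (r : R) (u : V) : 'I_k :=
  if r < x u 0 i then i else j u.

Variable L : seq (R * R).
Hypothesis L_ge0 : {in L, forall q : R * R, 0 <= q.1 /\ 0 <= q.2}.
Hypothesis L_sum : forall u i, \sum_(q <- L) q.1 * (q.2 < x u 0 i)%R%:R = x u 0 i.

(** The minimum is itself one of the two coordinates, on which [L] is exact. *)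
Lemma layer_sum_min u v i :
  \sum_(q <- L) q.1 * (q.2 < Num.min (x u 0 i) (x v 0 i))%R%:R
  = Num.min (x u 0 i) (x v 0 i).
Proof. by case: leP. Qed.

(** The edge can become cut only at thresholds exceeded by exactly one end, and for part [i] these
    have mass [|x u i - x v i|]. When [i = j u] the edge stays uncut, hence only an inequality. *)
Lemma relabel_excess_uncut u v : j u = j v ->
  \sum_i \sum_(q <- L) q.1 * excess_weight j (relabel i q.2) u v
    <= l1norm (x u - x v).
Proof.
move=> juv; rewrite /l1norm; apply: ler_sum => i _; rewrite !mxE normr_sub_min.
rewrite -(layer_sum_min u v i) -{1}(L_sum u i) -{1}(L_sum v i).
rewrite mulr_sumr -big_split -sumrB big_seq [leRHS]big_seq /=.
apply: ler_sum => q /L_ge0[q1 _].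
rewrite (mulrCA 2) -mulrDr -mulrBr ler_wpM2l // /excess_weight juv eqxx.
rewrite /relabel lt_min juv.
by case: (q.2 < x u 0 i); case: (q.2 < x v 0 i); rewrite ?eqxx /=;
  do ?case: eqP => _ /=; lra.
Qed.

(** Where both ends exceed the threshold they share label [i], contributing -4; elsewhere the excess
    is at most 0. Summed over [i], the former thresholds have mass [1 - l1norm (x u - x v) / 2]. *)
Lemma relabel_excess_cut u v : j u != j v ->
  \sum_i \sum_(q <- L) q.1 * excess_weight j (relabel i q.2) u v
    <= 2 * l1norm (x u - x v) - 4.
Proof.
move=> juv; rewrite l1norm_sub_simplex //.
suff: \sum_i \sum_(q <- L) q.1 * excess_weight j (relabel i q.2) u v
    <= \sum_i - 4 * Num.min (x u 0 i) (x v 0 i) by rewrite -mulr_sumr; lra.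
apply: ler_sum => i _; rewrite -(layer_sum_min u v i) mulr_sumr.
rewrite big_seq [leRHS]big_seq; apply: ler_sum => q /L_ge0[q1 _].
rewrite mulrCA ler_wpM2l // /excess_weight (negPf juv) /relabel lt_min.
by case: (q.2 < x u 0 i); case: (q.2 < x v 0 i); rewrite ?eqxx ?(negPf juv) /=;
  do ?case: eqP => _ /=; lra.
Qed.

(** The uncut bound is doubled to give both cases one form: [2 * (j u != j v)] is the l1 distance
    between the basis vectors of the two labels, so summing over edges compares the LP values of [x]
    and of [j]. *)
Lemma relabel_excess u v :
  \sum_i \sum_(q <- L) q.1 * excess_weight j (relabel i q.2) u v
    <= 2 * (l1norm (x u - x v) - 2 * (j u != j v)%:R).
Proof.
case: (eqVneq (j u) (j v)) => juv /=; last by have := relabel_excess_cut juv; lra.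
have := relabel_excess_uncut juv.
have : 0 <= l1norm (x u - x v) by apply: sumr_ge0.
lra.
Qed.

End Rounding.

Theorem theorem2 (R : realType) (V : finType) (k : nat)
    (I : mwc_instance R V k) (hstable : stable I 4) :
  forall x : V -> 'rV[R]_k, lp_optimal I x ->
    forall u : V, exists i : 'I_k, x u = std_basis i.
Proof.
move=> x [[xT x_simplex] x_opt].
have [_ [S [Scut _] Sstable]] := hstable.
have [j SE jT] := multiway_cut_labelling Scut.
have [L L_ge0 L_sum_in] :
    exists2 L : seq (R * R), {in L, forall q : R * R, 0 <= q.1 /\ 0 <= q.2} &
    {in [seq x p.1 0 p.2 | p : V * 'I_k],
      forall t, \sum_(q <- L) q.1 * (q.2 < t)%R%:R = t}.
  by apply: layer_cake => t /imageP[p _ ->]; case: (x_simplex p.1).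
have L_sum u i : \sum_(q <- L) q.1 * (q.2 < x u 0 i)%R%:R = x u 0 i.
  by apply: L_sum_in; apply/imageP; exists (u, i).
pose D i (q : R * R) := 2^-1 * \sum_(p in edges I)
  weight I p.1 p.2 * excess_weight j (relabel x j i q.2) p.1 p.2.
have D_gt0 i q : q \in L -> cut_of (relabel x j i q.2) <> S -> 0 < D i q.
  move=> /L_ge0[_ q2] neq; rewrite /D -excess_weightE subr_gt0 -SE.
  apply: Sstable neq; apply: multiway_cut_of => l.
  (* Terminal [l] keeps its label: for [i != l] its coordinate [i] is 0, which no threshold in [L]
     is below. *)
  rewrite /relabel xT mxE eqxx /= jT; case: eqVneq => [->|_]; first by case: ifP.
  by rewrite ltNge q2.
have D_ge0 i q : q \in L -> 0 <= D i q.
  move=> qL; case: (eqVneq (cut_of (relabel x j i q.2)) S) => [eqS|/eqP neqS].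
    by rewrite /D -excess_weightE -SE eqS setDv /edges_weight /edge_sum
      big_set0 !mulr0 subrr.
  exact/ltW/D_gt0.
have sumD_le0 : \sum_i \sum_(q <- L) q.1 * D i q <= 0.
  have -> : \sum_i \sum_(q <- L) q.1 * D i q = 2^-1 * \sum_(p in edges I)
      weight I p.1 p.2 *
      \sum_i \sum_(q <- L) q.1 * excess_weight j (relabel x j i q.2) p.1 p.2.
    under [in RHS]eq_bigr => p _ do rewrite mulr_sumr.
    rewrite [in RHS]exchange_big mulr_sumr /=; apply: eq_bigr => i _.
    under [in RHS]eq_bigr => p _ do rewrite mulr_sumr.
    rewrite [in RHS]exchange_big mulr_sumr /=; apply: eq_bigr => q _.
    rewrite mulrCA; congr (_ * _); rewrite mulr_sumr; apply: eq_bigr => p _.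
    by rewrite mulrCA.
  have le_excess : \sum_(p in edges I) weight I p.1 p.2 *
      \sum_i \sum_(q <- L) q.1 * excess_weight j (relabel x j i q.2) p.1 p.2
    <= \sum_(p in edges I) 2 * (weight I p.1 p.2 * l1norm (x p.1 - x p.2) -
        weight I p.1 p.2 * l1norm (std_basis (j p.1) - std_basis (j p.2) : 'rV[R]_k)).
    apply: ler_sum => p; rewrite inE => /weight_gt0 w_gt0.
    rewrite -mulrBr mulrCA ler_wpM2l ?(ltW w_gt0) // l1norm_sub_std_basis.
    exact: relabel_excess.
  (* The integral solution of [j] is feasible, so [x] costs no more; the weighted total of [D] is at
     most four times this difference in LP value. *)
  have := x_opt _ (lp_feasible_std_solution jT).
  rewrite /lp_value /edge_sum /std_solution.
  move: le_excess; rewrite -mulr_sumr sumrB; lra.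
move=> u; exists (j u); apply: simplex_vertex => // i iju.
have sumDi_ge0 l : 0 <= \sum_(q <- L) q.1 * D l q.
  rewrite big_seq; apply: sumr_ge0 => q qL.
  by rewrite mulr_ge0 ?D_ge0 //; case: (L_ge0 q qL).
(* The inner sums are nonnegative with nonpositive total, so each vanishes. *)
have : \sum_(q <- L | q \in L) q.1 * D i q == 0.
  rewrite -big_seq eq_le sumDi_ge0 andbT (le_trans _ sumD_le0) //.
  by rewrite (bigD1 i) //= lerDl sumr_ge0.
rewrite psumr_eq0 => [/allP cD0 | q qL]; last first.
  by rewrite mulr_ge0 ?D_ge0 //; case: (L_ge0 q qL).
(* Only layers below [x u 0 i] count. There [u] moves to part [i], so the cut differs from [S], [D]
   is positive, and the mass must be zero. *)
rewrite -L_sum big1_seq // => q /= qL.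
case: ltP => [rx|_]; last by rewrite mulr0.
have Dq_gt0 : 0 < D i q.
  apply: D_gt0 => //; rewrite SE => /ffunP/(_ i)/setP/(_ u).
  by rewrite !ffunE !inE /relabel rx eqxx eq_sym (negPf iju).
have := cD0 q qL; rewrite qL mulf_eq0 (gt_eqF Dq_gt0) orbF => /eqP->.
by rewrite mul0r.
Qed.
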